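(* There exists a finitely generated branch group with uncountably many maximal subgroups.
   Context: Let $(X_n)_{n\ge 1}$ be a sequence of finite sets of cardinality at least $2$. The associated rooted tree $T$ has as vertices all finite strings $x_1\dots x_n$ with $n\ge 0$, $x_i\in X_i$, with edges between $x_1\dots x_n$ and $x_1\dots x_nx_{n+1}$; the empty string is the root. The length of a string $v$ is denoted $|v|$, and the $n$-th layer $\mathcal{L}_T(n)$ is the set of vertices of length $n$. $\mathrm{Aut}(T)$ is the group of automorphisms of the rooted tree $T$, acting from the right. For $g\in\mathrm{Aut}(T)$ and a vertex $v$, the section $g|_v$ is the automorphism of the rooted tree of the shifted sequence $(X_{|v|+m})_{m\ge1}$ defined by $(vw).g=(v.g)(w.g|_v)$. A group $\Gamma\le\mathrm{Aut}(T)$ is spherically transitive if it acts transitively on every layer of $T$. The rigid vertex stabiliser $\mathrm{rist}_\Gamma(v)$ consists of all $g\in\Gamma$ fixing $\mathcal{L}_T(|v|)$ pointwise with $g|_u=\mathrm{id}$ for all $u\in\mathcal{L}_T(|v|)\smallsetminus\{v\}$, and $\mathrm{Rist}_\Gamma(n)=\langle\mathrm{rist}_\Gamma(v)\mid v\in\mathcal{L}_T(n)\rangle$. $\Gamma$ is a branch group if it is spherically transitive and $\mathrm{Rist}_\Gamma(n)$ has finite index in $\Gamma$ for all $n\ge0$. *)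

(* Defs.v *)
From HB Require Import structures.
From mathcomp Require Import all_boot.
From mathcomp Require Import boolp classical_sets functions cardinality.

Set Implicit Arguments.
Unset Strict Implicit.
Unset Printing Implicit Defensive.

Local Open Scope classical_set_scope.
Local Open Scope group_scope.

(* The alphabets are indexed from 0, so that X i is the (i+1)-st of them.     *)
(* vertex X k is the vertex set of the rooted tree of the shifted sequence    *)
(* X k, X k.+1, ...: strings whose letters, tagged with the index of the      *)
(* alphabet they come from, are taken successively in X k, X k.+1, ...        *)
Definition is_string (X : nat -> finType) (k : nat) (s : seq {i : nat & X i}) :=
  map tag s == iota k (size s).

Record vertex (X : nat -> finType) (k : nat) := Vertex {
  letters :> seq {i : nat & X i};
  lettersP : is_string k letters }.

HB.instance Definition _ X k := [isSub of vertex X k for @letters X k].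
HB.instance Definition _ X k := [Countable of vertex X k by <:].

Section Tree.
Variables (X : nat -> finType) (k : nat).
Implicit Types (u v : vertex X k) (s t : seq {i : nat & X i}).

Definition root : vertex X k := @Vertex X k [::] (eqxx _).

Definition child u v := exists x, letters v = rcons u x.

Definition adjacent u v := child u v \/ child v u.

Definition is_tree_aut (f : vertex X k -> vertex X k) :=
  [/\ bijective f, f root = root & forall u v, adjacent u v <-> adjacent (f u) (f v)].

Record tree_aut := TreeAut {
  aut_fun :> vertex X k -> vertex X k;
  aut_funP : is_tree_aut aut_fun }.

HB.instance Definition _ := gen_eqMixin tree_aut.
HB.instance Definition _ := gen_choiceMixin tree_aut.

Lemma tree_aut_ext (g h : tree_aut) : g =1 h -> g = h.
Proof.
case: g h => [f fP] [f' f'P] /= /funext eqf; case: _ / eqf in f'P *.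
by rewrite (Prop_irrelevance fP f'P).
Qed.

Lemma is_string_cat s t :
  is_string k (s ++ t) = is_string k s && is_string (k + size s) t.
Proof.
rewrite /is_string map_cat size_cat iotaD eqseq_cat //.
by rewrite size_map size_iota.
Qed.

Lemma is_tree_aut_id : is_tree_aut id.
Proof. by split=> //; exists id. Qed.

Lemma is_tree_aut_comp (g h : tree_aut) : is_tree_aut (h \o g).
Proof.
case: g h => [g [gb g1 ga]] [h [hb h1 ha]] /=; split.
- exact: bij_comp.
- by rewrite /= g1.
- by move=> u v; rewrite ga ha.
Qed.

Lemma aut_inv_ex (g : tree_aut) : exists f, cancel g f /\ cancel f g.
Proof. by case: g => [g [[f gK fK] ? ?]]; exists f. Qed.

Definition aut_inv_fun (g : tree_aut) := sval (cid (aut_inv_ex g)).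

Lemma aut_funK (g : tree_aut) : cancel g (aut_inv_fun g).
Proof. by rewrite /aut_inv_fun; case: cid => f []. Qed.

Lemma aut_inv_funK (g : tree_aut) : cancel (aut_inv_fun g) g.
Proof. by rewrite /aut_inv_fun; case: cid => f []. Qed.

Lemma is_tree_aut_inv (g : tree_aut) : is_tree_aut (aut_inv_fun g).
Proof.
have [_ g1 ga] := aut_funP g; split.
- by exists g; [exact: aut_inv_funK | exact: aut_funK].
- by rewrite -{1}g1 aut_funK.
- by move=> u v; rewrite [X in _ <-> X]ga !aut_inv_funK.
Qed.

(* Automorphisms act from the right: v.(g h) = (v.g).h, where v.g is written  *)
(* g v.                                                                       *)
Definition aut_mul (g h : tree_aut) := TreeAut (is_tree_aut_comp g h).
Definition aut_one := TreeAut is_tree_aut_id.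
Definition aut_inv (g : tree_aut) := TreeAut (is_tree_aut_inv g).

Lemma aut_mulA : associative aut_mul.
Proof. by move=> *; exact: tree_aut_ext. Qed.
Lemma aut_mul1g : left_id aut_one aut_mul.
Proof. by move=> *; exact: tree_aut_ext. Qed.
Lemma aut_mulg1 : right_id aut_one aut_mul.
Proof. by move=> *; exact: tree_aut_ext. Qed.
Lemma aut_mulVg : left_inverse aut_one aut_inv aut_mul.
Proof. by move=> g; apply: tree_aut_ext => v; exact: aut_inv_funK. Qed.
Lemma aut_mulgV : right_inverse aut_one aut_inv aut_mul.
Proof. by move=> g; apply: tree_aut_ext => v; exact: aut_funK. Qed.

HB.instance Definition _ := isGroup.Build tree_aut
  aut_mulA aut_mul1g aut_mulg1 aut_mulVg aut_mulgV.

Lemma child_size u v : child u v -> size v = (size u).+1.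
Proof. by case=> x ->; rewrite size_rcons. Qed.

Lemma child_inj u u' v : child u v -> child u' v -> u = u'.
Proof.
by case=> x vE [y] /eqP; rewrite vE eqseq_rcons => /andP[/eqP uu' _]; exact: val_inj.
Qed.

Lemma vertex_ind (P : vertex X k -> Prop) :
  P root -> (forall u v, child u v -> P u -> P v) -> forall v, P v.
Proof.
move=> P0 PS [s sP]; elim/last_ind: s sP => [|s x IH] sP.
  by rewrite (_ : Vertex _ = root)//; exact: val_inj.
have sP' : is_string k s by move: (sP); rewrite -cats1 is_string_cat => /andP[].
by apply: (PS (Vertex sP')); [exists x | exact: IH].
Qed.

Lemma aut_size_child (g : tree_aut) v :
  size (g v) = size v /\ (forall u, child u v -> child (g u) (g v)).
Proof.
have [gb g1 ga] := aut_funP g.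
elim/vertex_ind: v => [|u v uv [su IH]].
  rewrite g1; split=> // u [x]; by case: (letters u).
have guv : child (g u) (g v).
  have [//|gvu] : adjacent (g u) (g v) by rewrite -ga; left.
  exfalso; elim/vertex_ind: u {su} uv IH gvu => [|w u wu _] uv IH gvu.
    by move/child_size: gvu; rewrite g1.
  have wv : w = v by apply: (bij_inj gb); exact: child_inj (IH _ wu) gvu.
  by move: (child_size uv) (child_size wu); rewrite wv => -> /eqP; rewrite -addn2 -[X in X == _]addn0 eqn_add2l.
split; first by rewrite (child_size guv) (child_size uv) su.
by move=> u' u'v; rewrite (child_inj u'v uv).
Qed.

Lemma aut_size (g : tree_aut) v : size (g v) = size v.
Proof. by case: (aut_size_child g v). Qed.

Lemma aut_child (g : tree_aut) u v : child u v -> child (g u) (g v).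
Proof. by case: (aut_size_child g v) => _ H; exact: H. Qed.

Lemma cat_vertexP v (w : vertex X (k + size v)) : is_string k (letters v ++ w).
Proof. by rewrite is_string_cat !lettersP. Qed.

Definition cat_vertex v (w : vertex X (k + size v)) := Vertex (cat_vertexP w).

Lemma take_aut (g : tree_aut) v (w : vertex X k) :
  take (size v) w = letters v -> take (size v) (g w) = g v.
Proof.
elim/vertex_ind: w => [|w' w w'w IH] tw.
  have v0 : v = root by apply: val_inj; rewrite /= -tw.
  by rewrite v0 take0; have [_ ->] := aut_funP g.
have [szv|szv] := leqP (size v) (size w').
  have [x wE] := w'w; have [y gwE] := aut_child g w'w.
  rewrite gwE -cats1 takel_cat ?aut_size// IH//.
  by move: tw; rewrite wE -cats1 takel_cat.
have wv : w = v.
  by apply: val_inj; rewrite /= -tw take_oversize// (child_size w'w).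
by rewrite wv -[X in take X _](aut_size g v) take_size.
Qed.

Lemma section_funP (g : tree_aut) v (w : vertex X (k + size v)) :
  is_string (k + size v) (drop (size v) (g (cat_vertex w))).
Proof.
have := lettersP (g (cat_vertex w)).
rewrite -{1}(cat_take_drop (size v) (g _)) is_string_cat => /andP[_].
by rewrite size_takel// aut_size /= size_cat leq_addr.
Qed.

Definition section_fun (g : tree_aut) v (w : vertex X (k + size v)) :=
  Vertex (section_funP g w).

(* (v w).g = (v.g) (w.g|_v)                                                   *)
Lemma section_funE (g : tree_aut) v (w : vertex X (k + size v)) :
  letters (g (cat_vertex w)) = letters (g v) ++ section_fun g w.
Proof. by rewrite -(@take_aut g v (cat_vertex w)) /= ?cat_take_drop ?take_size_cat. Qed.

Lemma section_fun_bij (g : tree_aut) v : bijective (@section_fun g v).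
Proof.
have gv_str (w : vertex X (k + size v)) : is_string k (letters (g v) ++ w).
  by rewrite is_string_cat aut_size !lettersP.
pose gw w := Vertex (gv_str w).
have take_ginv w : take (size v) (aut_inv_fun g (gw w)) = letters v.
  have := @take_aut (aut_inv g) (g v) (gw w).
  rewrite /= aut_funK aut_size => -> //.
  exact/take_size_cat/aut_size.
have ginvP w : is_string (k + size v) (drop (size v) (aut_inv_fun g (gw w))).
  have := lettersP (aut_inv_fun g (gw w)).
  rewrite -{1}(cat_take_drop (size v) (aut_inv_fun g _)) is_string_cat.
  by rewrite take_ginv => /andP[].
exists (fun w => Vertex (ginvP w)) => w; apply: val_inj => /=.
  rewrite (_ : gw _ = g (cat_vertex w)) ?aut_funK /= ?drop_size_cat//.
  by apply: val_inj; rewrite /= -section_funE.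
rewrite (_ : cat_vertex _ = aut_inv_fun g (gw w)).
  by rewrite aut_inv_funK; exact/drop_size_cat/aut_size.
by apply: val_inj; rewrite /= -[X in X ++ _](take_ginv w) cat_take_drop.
Qed.

End Tree.

Lemma section_is_tree_aut X k (g : tree_aut X k) (v : vertex X k) :
  is_tree_aut (section_fun g (v := v)).
Proof.
have childE w w' : child w w' <-> child (cat_vertex w) (cat_vertex (v := v) w').
  split=> -[x wE]; exists x; first by rewrite /= wE rcons_cat.
  by move: wE => /= /eqP; rewrite rcons_cat eqseq_cat// => /andP[_ /eqP].
have gchildE u u' : child u u' <-> child (g u) (g u').
  split=> [|gu]; first exact: aut_child.
  by rewrite -(aut_funK g u) -(aut_funK g u'); exact: (@aut_child _ _ (aut_inv g)).
have schildE w w' : child (section_fun g (v := v) w) (section_fun g w')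
    <-> child (g (cat_vertex w)) (g (cat_vertex w')).
  rewrite /child !section_funE; split=> -[x wE]; exists x.
    by rewrite wE rcons_cat.
  by move: wE => /eqP; rewrite rcons_cat eqseq_cat// => /andP[_ /eqP].
split; first exact: section_fun_bij.
  apply: val_inj => /=; apply: size0nil.
  by rewrite size_drop aut_size size_cat addn0 subnn.
move=> w w'; rewrite /adjacent !schildE -!gchildE.
by rewrite -!childE.
Qed.

Definition tree_section X k (g : tree_aut X k) (v : vertex X k) :
  tree_aut X (k + size v) := TreeAut (section_is_tree_aut g v).

Section Subgroups.
Variable G : groupType.
Implicit Types H K M S : set G.

Definition subgroup H := group_closed (mem H).

Definition generated S : set G := smallest subgroup S.

Definition finitely_generated H := exists2 S, finite_set S & H = generated S.

Definition right_cosets H K : set (set G) :=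
  [set [set h * x | h in H] | x in K].

Definition finite_index H K := [/\ subgroup H, H `<=` K & finite_set (right_cosets H K)].

Definition maximal_subgroup M H :=
  [/\ subgroup M, M `<` H &
      forall K, subgroup K -> M `<=` K -> K `<=` H -> K = M \/ K = H].

End Subgroups.

Section Branch.
Variable X : nat -> finType.
Implicit Types (Gamma : set (tree_aut X 0)) (u v : vertex X 0).

Definition spherically_transitive Gamma :=
  forall u v, size u = size v -> exists2 g, Gamma g & g u = v.

Definition rist Gamma v : set (tree_aut X 0) :=
  [set g | [/\ Gamma g,
               forall u, size u = size v -> g u = u &
               forall u, size u = size v -> u <> v -> tree_section g u = 1]].

Definition Rist Gamma n : set (tree_aut X 0) :=
  generated (\bigcup_(v in [set v : vertex X 0 | size v = n]) rist Gamma v).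

Definition branch Gamma :=
  spherically_transitive Gamma /\ forall n, finite_index (Rist Gamma n) Gamma.

End Branch.

(* Main.v *)
(* Let B be a finitely generated perfect group acting on every alphabet X n. The rooted
   permutations b and the spinal automorphisms b~ (whose sections along a fixed ray are again
   spinal, with a rooted copy of b next to the ray at each level) generate a group Gamma. As B
   is perfect, commutators of spinal elements with rotated spinal elements produce every
   generator acting below one single vertex, so Gamma is a branch group. For a subgroup H of B
   let Gamma_H be generated by the rooted B and by the b~ with b in H. Deep sections of an
   element of Gamma_H are rooted or spinal with label in H, so Gamma_H is proper if no element
   of H agrees with some fixed b on almost all levels. Hence it suffices that B has uncountably
   many such subgroups any two of which generate B: maximal subgroups of Gamma above the
   Gamma_H exist since Gamma is finitely generated, and they are pairwise distinct.

   B acts on six copies (sheets) of a cycle. It is generated by the alternating group A6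
   permuting the sheets, by A6 acting only over a region U of the cycle, and by the conjugate of
   A6 by the rotation of three of the sheets. The region U at level n spells all bit patterns of
   length n, so an infinite bit string s determines at each level a place of the cycle where its
   n-th prefix is spelled, and H = H_s consists of the elements fixing almost all these places
   on sheet 0. If s and t differ at k, then the k-th shift V of U eventually contains exactly
   one of the two places; since a generator is the product of its restrictions to V and to the
   complement of V, which belong to B, it lies in the group generated by H_s and H_t. *)
From mathcomp Require Import all_boot all_fingroup all_solvable.
From mathcomp Require Import boolp classical_sets functions cardinality.
Require Import Defs.

Set Implicit Arguments.
Unset Strict Implicit.
Unset Printing Implicit Defensive.

Local Open Scope classical_set_scope.
Local Open Scope group_scope.

(** * Induction principles for the alternating group A6 *)

Notation sheet := 'I_6.
Notation A6 := 'Alt_(sheet).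

Definition ish (k : nat) : sheet := inord k.

Lemma ish_eq j k : (j < 6)%N -> (k < 6)%N -> (ish j == ish k) = (j == k).
Proof. by move=> j6 k6; rewrite -val_eqE /= !inordK. Qed.

Lemma ish_neq j k : (j < 6)%N -> (k < 6)%N -> j != k -> ish j != ish k.
Proof. by move=> *; rewrite ish_eq. Qed.

Lemma simple_A6 : simple A6.
Proof. by apply: simple_Alt5; rewrite card_ord. Qed.

Lemma card_A6 : #|A6| = 360.
Proof. by apply/eqP; rewrite -(eqn_pmul2l (m := 2))// card_Alt card_ord. Qed.

Lemma perfect_A6 : [~: A6, A6] = A6.
Proof.
have /simpleP[_ /(_ _ (der_normal 1 _))[|//]] := simple_A6.
(* A trivial derived subgroup would make [A6] abelian, hence of prime order. *)
move=> /commG1P/abelian_sol solA.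
by have [] := simple_sol_prime solA simple_A6; rewrite card_A6.
Qed.

Section AlternatingInduction.
Variable P : {perm sheet} -> Prop.
Hypotheses (P1 : P 1) (PM : forall p q, P p -> P q -> P (p * q)).

(** In a finite group, closure under products already gives inverses. *)
Lemma asbool_group_set : group_set [set p | `[< P p >]]%SET.
Proof.
apply/group_setP; split=> [|p q]; rewrite !inE //; exact: PM.
Qed.
Let H := Group asbool_group_set.

Lemma A6_commutator_ind :
  (forall p q, p \in A6 -> q \in A6 -> P [~ p, q]) -> forall p, p \in A6 -> P p.
Proof.
move=> PR p; rewrite -perfect_A6 => pA; suff: p \in H by rewrite !inE.
move: p pA; apply/fintype.subsetP; rewrite gen_subG; apply/fintype.subsetP => _ /imset2P[q r qA rA ->].
by rewrite !inE; exact: PR.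
Qed.

(** The elements of [A6] satisfying [P] form a normal subgroup; it contains [p0], so simplicity
    makes it all of [A6]. *)
Lemma A6_conjugation_ind (p0 : {perm sheet}) :
  p0 \in A6 -> p0 != 1 -> P p0 ->
  (forall p q, p \in A6 -> q \in A6 -> P p -> P (p ^ q)) ->
  forall p, p \in A6 -> P p.
Proof.
move=> p0A p0N1 Pp0 PJ p pA; have /simpleP[_ simA] := simple_A6.
have nK : (A6 :&: H)%G <| A6.
  apply/andP; split; first exact: subsetIl.
  apply/fintype.subsetP => q qA; rewrite inE; apply/fintype.subsetP => _ /imsetP[r + ->].
  rewrite finset.in_setI => /andP[rA]; rewrite finset.in_setI groupJ// !inE => Pr.
  exact: PJ.
have [K1|KA] := simA _ nK; last by move: pA; rewrite -KA finset.in_setI => /andP[_]; rewrite !inE.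
have : p0 \in A6 :&: H by rewrite finset.in_setI p0A !inE.
by rewrite [_ :&: _]K1 finset.in_set1 (negPf p0N1).
Qed.
End AlternatingInduction.

(** For distinct sheets, the 3-cycle i -> j -> k -> i. *)
Definition cyc3 (i j k : sheet) : {perm sheet} := tperm i j * tperm i k.

Lemma cyc3_Alt i j k : i != j -> i != k -> cyc3 i j k \in A6.
Proof. by move=> ij ik; rewrite Alt_even odd_permM !odd_tperm ij ik. Qed.

Lemma cyc3E i j k : i != k -> j != k -> cyc3 i j k j = k.
Proof. by move=> ik jk; rewrite permM tpermR tpermL. Qed.

Lemma cyc3D i j k l : l != i -> l != j -> l != k -> cyc3 i j k l = l.
Proof. by move=> li lj lk; rewrite permM !tpermD // eq_sym. Qed.

(** * Sheets over a cycle *)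

Definition patterns n : seq bitseq := [seq val w | w : n.-tuple bool].
(** One block of [n.+1] places per pattern; the padding keeps the cycle nonempty at [n = 0]. *)
Definition N n : nat := (size (patterns n) * n.+1)%N.
Definition X n : finType := (sheet * 'I_(N n))%type.

Lemma mem_patterns (s : nat -> bool) n : mkseq s n \in patterns n.
Proof. by apply/codomP; exists (Tuple (introT eqP (size_mkseq s n))). Qed.

Lemma spot_subproof (s : nat -> bool) n :
  (index (mkseq s n) (patterns n) * n.+1 < N n)%N.
Proof. by rewrite ltn_pmul2r// index_mem mem_patterns. Qed.

Definition spot s n : 'I_(N n) := Ordinal (spot_subproof s n).

Definition region := forall n, pred 'I_(N n).

Definition full : region := fun n _ => true.
Arguments full n _ : clear implicits.

(* The y-th bit of the concatenation of all bit patterns of length n (padded to length n.+1). *)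
Definition letter : region := fun n y =>
  nth false (nth [::] (patterns n) (y %/ n.+1)) (y %% n.+1).
Arguments letter n y : clear implicits.

Definition shift (W : region) : region := fun n y => W n (ordS y).
Arguments shift W n y : clear implicits.

Lemma iter_shift k n y : iter k shift letter n y = letter n (iter k (@ordS (N n)) y).
Proof. by elim: k y => //= k IHk y; rewrite /shift IHk -iterS iterSr. Qed.

Lemma letter_spot s k n : (k < n)%N -> iter k shift letter n (spot s n) = s k.
Proof.
move=> kn; rewrite iter_shift.
(* The walk of [k] steps does not wrap around the cycle. *)
have pk : (spot s n + k < N n)%N.
  have : (index (mkseq s n) (patterns n) < size (patterns n))%N.
    by rewrite index_mem mem_patterns.
  rewrite -(@leq_pmul2r n.+1)// => /(leq_trans _) -> //.
  by rewrite mulSn addnC ltn_add2r ltnS ltnW.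
have iterE j : (j <= k)%N -> iter j (@ordS (N n)) (spot s n) = (spot s n + j)%N :> nat.
  elim: j => [_|j IHj jk] /=; first by rewrite addn0.
  rewrite IHj; last exact: ltnW.
  by rewrite modn_small -addnS//; apply: leq_ltn_trans pk; rewrite leq_add2l.
rewrite /letter iterE//= divnMDl// modnMDl divn_small ?modn_small ?ltnS 1?ltnW//.
by rewrite addn0 nth_index ?mem_patterns// nth_mkseq.
Qed.

(** * Families of maps on the alphabets *)

Definition fam := forall n, X n -> X n.
Definition fone : fam := fun n x => x.
Arguments fone n x : clear implicits.
(** Here [c] acts first, whereas products of permutations act from left to right; hence the reversed
    order in [twistM]. *)
Definition fmul (b c : fam) : fam := fun n x => b n (c n x).
Arguments fmul b c n x : clear implicits.

Lemma famP (b c : fam) : (forall n x, b n x = c n x) -> b = c.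
Proof. by move=> bc; do 2 (apply: functional_extensionality_dep => ?); exact: bc. Qed.

Definition twist (W : region) (p : {perm sheet}) : fam := fun n x =>
  if W n x.2 then (p x.1, x.2) else x.
Arguments twist W p n x : clear implicits.

Definition roll : fam := fun n x => if (x.1 < 3)%N then x else (x.1, ord_pred x.2).
Arguments roll n x : clear implicits.
Definition unroll : fam := fun n x => if (x.1 < 3)%N then x else (x.1, ordS x.2).
Arguments unroll n x : clear implicits.

Definition conj_roll (b : fam) : fam := fmul roll (fmul b unroll).
Arguments conj_roll b n x : clear implicits.

Lemma rollK : fmul unroll roll = fone.
Proof.
by apply: famP => n [i y]; rewrite /fmul /roll /unroll /=; case i3: (i < 3)%N; rewrite /= i3 //= ord_predK.
Qed.

Lemma unrollK : fmul roll unroll = fone.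
Proof.
by apply: famP => n [i y]; rewrite /fmul /roll /unroll /=; case i3: (i < 3)%N; rewrite /= i3 //= ordSK.
Qed.

Lemma conj_roll1 : conj_roll fone = fone.
Proof. exact: unrollK. Qed.

Lemma conj_rollM b c : conj_roll (fmul b c) = fmul (conj_roll b) (conj_roll c).
Proof.
apply: famP => n x; rewrite /conj_roll /fmul.
by have /(congr1 (fun f : fam => f n (c n (unroll n x)))) := rollK; rewrite /fmul => ->.
Qed.

Lemma twist1 W : twist W 1 = fone.
Proof. by apply: famP => n [i y]; rewrite /twist /= perm1 if_same. Qed.

Lemma twistM W p q : twist W (p * q) = fmul (twist W q) (twist W p).
Proof. by apply: famP => n [i y]; rewrite /fmul /twist /=; case W_y: (W n y); rewrite /= ?W_y ?permM. Qed.

(** Outside the intersection of [W] and [V] at most one of the twists acts, so the commutator is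
    trivial there. *)
Lemma twist_commutator W V p q :
  twist (fun n y => W n y && V n y) [~ p, q] =
  fmul (twist V q) (fmul (twist W p) (fmul (twist V q^-1) (twist W p^-1))).
Proof.
apply: famP => n [i y]; rewrite /fmul /twist /=.
case W_y: (W n y); case V_y: (V n y); rewrite /= ?W_y ?V_y /= ?W_y ?V_y /= ?W_y ?V_y //=.
- by rewrite !permM.
- by rewrite permKV.
- by rewrite permKV.
Qed.

Lemma twist_conj W p q :
  twist W (p ^ q) = fmul (twist full q) (fmul (twist W p) (twist full q^-1)).
Proof.
by apply: famP => n [i y]; rewrite /fmul /twist /=; case: (W n y); rewrite /= ?permM ?permKV.
Qed.

Lemma twist_split W V p :
  twist W p = fmul (twist (fun n y => W n y && V n y) p)
                   (twist (fun n y => W n y && ~~ V n y) p).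
Proof.
apply: famP => n [i y]; rewrite /fmul /twist /=.
by case W_y: (W n y); case V_y: (V n y); rewrite /= ?W_y ?V_y.
Qed.

(* Since [roll] is trivial on sheets 0, 1, 2 and is a shift on sheets 3, 4, 5,
   these two lemmas let a rotation trade the region W for its shift. *)
Lemma conj_roll_low W : conj_roll (twist W (cyc3 (ish 0) (ish 1) (ish 2))) =
  twist W (cyc3 (ish 0) (ish 1) (ish 2)).
Proof.
have low l : (cyc3 (ish 0) (ish 1) (ish 2) l < 3)%N = (l < 3)%N.
  rewrite permM; case: (tpermP _ _ l) => [->|->|_ _].
  - by case: tpermP => *; rewrite ?inordK.
  - by case: tpermP => *; rewrite ?inordK.
  by case: tpermP => [->|->|//]; rewrite !inordK.
apply: famP => n [i y]; rewrite /conj_roll /fmul /roll /unroll /twist /=.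
case: (ltnP i 3) => i3 /=; first by case: (W n y); rewrite /= ?low i3.
rewrite cyc3D; try by apply: contraTneq i3 => ->; rewrite inordK.
by rewrite !if_same /= ltnNge i3 /= ordSK.
Qed.

Lemma conj_roll_high W : conj_roll (twist W (cyc3 (ish 3) (ish 4) (ish 5))) =
  twist (shift W) (cyc3 (ish 3) (ish 4) (ish 5)).
Proof.
have low l : (cyc3 (ish 3) (ish 4) (ish 5) l < 3)%N = (l < 3)%N.
  rewrite permM; case: (tpermP _ _ l) => [->|->|_ _].
  - by case: tpermP => *; rewrite ?inordK.
  - by case: tpermP => *; rewrite ?inordK.
  by case: tpermP => [->|->|//]; rewrite !inordK.
apply: famP => n [i y]; rewrite /conj_roll /fmul /roll /unroll /twist /shift /=.
case: (ltnP i 3) => i3 /=; last first.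
  by case: (W n (ordS y)); rewrite /= ?low ltnNge i3 /= ordSK.
rewrite cyc3D; try by apply: contraTneq i3 => ->; rewrite inordK.
by rewrite !if_same /= i3.
Qed.

(** * The group B *)

Definition gen (k : option bool) (p : {perm sheet}) : fam :=
  if k is Some e then twist (if e then letter else full) p
  else conj_roll (twist full p).
Arguments gen k p n x : clear implicits.

(** Products suffice: the generators come in copies of [A6], so inverses follow. *)
Inductive B : fam -> Prop :=
| B_one : B fone
| B_gen k p : p \in A6 -> B (gen k p)
| B_mul b c : B b -> B c -> B (fmul b c).

Lemma B_twist_full p : p \in A6 -> B (twist full p).
Proof. exact: (@B_gen (Some false)). Qed.

Lemma B_letter p : p \in A6 -> B (twist letter p).
Proof. exact: (@B_gen (Some true)). Qed.

Lemma B_roll_full p : p \in A6 -> B (conj_roll (twist full p)).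
Proof. exact: (@B_gen None). Qed.

Lemma gen1 k : gen k 1 = fone.
Proof. by case: k => [e|] /=; rewrite twist1 ?conj_roll1. Qed.

Lemma genM k p q : gen k (p * q) = fmul (gen k q) (gen k p).
Proof. by case: k => [e|] /=; rewrite twistM ?conj_rollM. Qed.

Lemma B_inv b : B b -> exists b', [/\ B b', fmul b' b = fone & fmul b b' = fone].
Proof.
elim=> [|k p pA|b1 b2 _ [c1 [C1 c1b1 b1c1]] _ [c2 [C2 c2b2 b2c2]]].
- by exists fone; split=> //; exact: B_one.
- exists (gen k p^-1); split; first by apply: B_gen; rewrite groupV.
  + by rewrite -genM mulgV gen1.
  + by rewrite -genM mulVg gen1.
- exists (fmul c2 c1); split; first exact: B_mul.
  + by rewrite -[LHS]/(fmul c2 (fmul (fmul c1 b1) b2)) c1b1.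
  + by rewrite -[LHS]/(fmul b1 (fmul (fmul b2 c2) c1)) b2c2.
Qed.

(** Rotation fixes twists by the 3-cycle on sheets 0, 1, 2; conjugation by rotated full twists,
    which lie in [B], spreads this one case over [A6]. *)
Lemma B_conj_roll W : (forall p, p \in A6 -> B (twist W p)) ->
  forall p, p \in A6 -> B (conj_roll (twist W p)).
Proof.
move=> BW; apply: (@A6_conjugation_ind _ _ _ (cyc3 (ish 0) (ish 1) (ish 2))).
- by rewrite twist1 conj_roll1; exact: B_one.
- by move=> p q Bp Bq; rewrite twistM conj_rollM; exact: B_mul.
- by apply: cyc3_Alt; rewrite ish_neq.
- apply/eqP => /permP/(_ (ish 1)); rewrite perm1 cyc3E ?ish_neq// => /eqP.
  by rewrite ish_eq.
- by rewrite conj_roll_low; apply/BW/cyc3_Alt; rewrite ish_neq.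
- move=> p q pA qA Bp; rewrite twist_conj !conj_rollM.
  by apply: B_mul; [|apply: B_mul => //]; apply: B_roll_full; rewrite ?groupV.
Qed.

(** For the 3-cycle on sheets 3, 4, 5 rotation replaces [W] by its shift; conjugation by full twists
    gives the rest of [A6]. *)
Lemma B_shift W : (forall p, p \in A6 -> B (twist W p)) ->
  forall p, p \in A6 -> B (twist (shift W) p).
Proof.
move=> BW; have p0A : cyc3 (ish 3) (ish 4) (ish 5) \in A6 by apply: cyc3_Alt; rewrite ish_neq.
apply: (A6_conjugation_ind _ _ p0A).
- by rewrite twist1; exact: B_one.
- by move=> p q Bp Bq; rewrite twistM; exact: B_mul.
- apply/eqP => /permP/(_ (ish 4)); rewrite perm1 cyc3E ?ish_neq// => /eqP.
  by rewrite ish_eq.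
- by rewrite -conj_roll_high; exact: B_conj_roll.
- move=> p q pA qA Bp; rewrite twist_conj.
  by apply: B_mul; [|apply: B_mul => //]; apply: B_twist_full; rewrite ?groupV.
Qed.

Lemma B_iter_shift k p : p \in A6 -> B (twist (iter k shift letter) p).
Proof. by elim: k p => [|k IHk]; [exact: B_letter | exact: B_shift]. Qed.

Definition regionI (W V : region) : region := fun n y => W n y && V n y.
Definition regionD (W V : region) : region := fun n y => W n y && ~~ V n y.

(** Perfectness reduces this to commutators, and those of twists over [W] with twists over [V] live
    on the intersection. *)
Lemma B_twistI W V :
  (forall p, p \in A6 -> B (twist W p)) -> (forall p, p \in A6 -> B (twist V p)) ->
  forall p, p \in A6 -> B (twist (regionI W V) p).
Proof.
move=> BW BV; apply: A6_commutator_ind.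
- by rewrite twist1; exact: B_one.
- by move=> p q Bp Bq; rewrite twistM; exact: B_mul.
- move=> p q pA qA; rewrite twist_commutator.
  apply: B_mul; first exact: BV.
  apply: B_mul; first exact: BW.
  by apply: B_mul; [apply: BV | apply: BW]; rewrite groupV.
Qed.

Lemma B_twistD W V :
  (forall p, p \in A6 -> B (twist W p)) -> (forall p, p \in A6 -> B (twist V p)) ->
  forall p, p \in A6 -> B (twist (regionD W V) p).
Proof.
move=> BW BV p pA.
rewrite (_ : twist _ p = fmul (twist (regionI W V) p^-1) (twist W p)).
  by apply: B_mul; [apply: B_twistI; rewrite ?groupV | exact: BW].
rewrite (twist_split W V) -/(regionI _ _) -/(regionD _ _).
rewrite -[LHS]/(fmul fone _) -[in LHS](twist1 (regionI W V)) -[in LHS](mulgV p) twistM.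
by [].
Qed.

(** * The subgroups H_s of B *)

(* H_s in the notation of the header. *)
Definition stab (s : nat -> bool) (b : fam) :=
  B b /\ exists m, forall n, (m <= n)%N -> b n (ish 0, spot s n) = (ish 0, spot s n).

Lemma stab_one s : stab s fone.
Proof. by split; [exact: B_one | exists 0]. Qed.

Lemma stab_mul s b c : stab s b -> stab s c -> stab s (fmul b c).
Proof.
move=> [Bb [m mb]] [Bc [k kc]]; split; first exact: B_mul.
by exists (maxn m k) => n; rewrite geq_max => /andP[/mb bn /kc cn]; rewrite /fmul cn bn.
Qed.

Lemma stab_inv s b : stab s b ->
  exists b', [/\ stab s b', fmul b' b = fone & fmul b b' = fone].
Proof.
move=> [Bb [m mb]]; have [b' [Bb' b'b bb']] := B_inv Bb.
exists b'; split=> //; split=> //; exists m => n /mb bn.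
have /(congr1 (fun f : fam => f n (ish 0, spot s n))) := b'b.
by rewrite /fmul bn.
Qed.

(** The witness moves sheet 0 to sheet 1 over every place, so it disagrees with each element of
    [stab s] at all large levels. *)
Lemma stab_proper s : exists2 b, B b &
  forall c m, stab s c -> (forall n, (m <= n)%N -> forall x, b n x = c n x) -> False.
Proof.
exists (twist full (cyc3 (ish 0) (ish 1) (ish 2))).
  by apply: B_twist_full; apply: cyc3_Alt; rewrite ish_eq.
move=> c m [_ [k kc]] bc; have := kc _ (leq_maxr m k); rewrite -bc ?leq_maxl//.
rewrite /twist /= permM tpermL tpermD ?ish_eq// => -[/eqP].
by rewrite ish_eq.
Qed.

Lemma twist_fix (W : region) n x p : ~~ W n x.2 -> twist W p n x = x.
Proof. by rewrite /twist => /negPf->. Qed.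

Lemma conj_roll_twist_fix (W : region) n y p :
  ~~ W n y -> conj_roll (twist W p) n (ish 0, y) = (ish 0, y).
Proof.
by move=> Wy; rewrite /conj_roll /fmul /unroll /roll /= inordK //= twist_fix//= inordK.
Qed.

Lemma stab_generate s t (C : fam -> Prop) : s <> t ->
  C fone -> (forall b c, C b -> C c -> C (fmul b c)) ->
  (forall b, stab s b -> C b) -> (forall b, stab t b -> C b) ->
  forall b, B b -> C b.
Proof.
move=> st C1 CM.
have [k skt] : exists k, s k != t k.
  by apply: contra_notP st => /forallNP st; apply/funext => k; apply/eqP/negP => /negP/st.
wlog sk : s t st skt / s k = true.
  move=> H Cs Ct; case sk: (s k); first exact: (H s t).
  by apply: (H t s) => //; [exact/nesym | rewrite eq_sym | move: skt; rewrite sk; case: (t k)].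
have tk : t k = false by move: skt; rewrite sk; case: (t k).
move=> Cs Ct b; elim=> [//|e p pA|{}b c _ Cb _ Cc]; last exact: CM.
(* Beyond level [k], [V] contains the place of [s] and not that of [t]; twists over parts of [V] fix
   the latter and twists off [V] the former. *)
pose V := iter k shift letter.
have BV q : q \in A6 -> B (twist V q) by exact: B_iter_shift.
have CT W : (forall p, p \in A6 -> B (twist W p)) -> C (twist W p).
  move=> BW; rewrite (twist_split W V); apply: CM.
    apply: Ct; split; first exact: B_twistI.
    by exists k.+1 => n kn; rewrite twist_fix//= negb_and /V letter_spot// tk orbT.
  apply: Cs; split; first exact: B_twistD.
  by exists k.+1 => n kn; rewrite twist_fix//= negb_and /V letter_spot// sk orbT.
case: e => [[]|] /=.
- by apply: CT; exact: B_letter.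
- by apply: CT; exact: B_twist_full.
(* The splitting precedes the rotation, which is trivial on sheet 0, so the same places stay
   fixed. *)
rewrite (twist_split full V) conj_rollM; apply: CM.
  apply: Ct; split; first by apply: B_conj_roll => //; apply: B_twistI => //; exact: B_twist_full.
  by exists k.+1 => n kn; rewrite conj_roll_twist_fix//= /V letter_spot// tk.
apply: Cs; split; first by apply: B_conj_roll => //; apply: B_twistD => //; exact: B_twist_full.
by exists k.+1 => n kn; rewrite conj_roll_twist_fix//= /V letter_spot// sk.
Qed.

(** * Transitivity of B on each alphabet *)

Lemma B_cycle : exists2 b, B b & forall n y, b n (ish 0, y) = (ish 0, ord_pred y).
Proof.
(* The right factor sends sheet 0 to sheet 3 with one step back, the left factor returns to sheet
   0. *)
exists (fmul (twist full (cyc3 (ish 1) (ish 3) (ish 0)))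
             (conj_roll (twist full (cyc3 (ish 1) (ish 0) (ish 3))))).
  by apply: B_mul; [apply: B_twist_full | apply: B_roll_full]; apply: cyc3_Alt; rewrite ish_neq.
move=> n y; rewrite /fmul /conj_roll /fmul /unroll /twist /= inordK //= cyc3E ?ish_neq//.
by rewrite /roll /= inordK //= cyc3E ?ish_neq.
Qed.

Lemma B_transitive n (x x' : X n) : exists2 b, B b & b n x = x'.
Proof.
have to_sheet0 i y : exists2 b, B b & b n (i, y) = (ish 0, y).
  have [->|i0] := eqVneq i (ish 0); first by exists fone; first exact: B_one.
  (* A third sheet, to complete a 3-cycle taking [i] to 0. *)
  have [a ai a0] : exists2 a, a != i & a != ish 0.
    have [->|i1] := eqVneq i (ish 1); first by exists (ish 2); rewrite ish_neq.
    by exists (ish 1); rewrite 1?eq_sym ?ish_neq// eq_sym.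
  exists (twist full (cyc3 a i (ish 0))); first exact/B_twist_full/cyc3_Alt.
  by rewrite /twist /= cyc3E.
have [c Bc cE] := B_cycle.
(* Iterating [c] walks back along sheet 0 to place 0. *)
have to_base m (y : 'I_(N n)) : y = m :> nat ->
    exists2 b, B b & forall y0 : 'I_(N n), y0 = 0 :> nat -> b n (ish 0, y) = (ish 0, y0).
  elim: m y => [|m IHm] y ym.
    exists fone; first exact: B_one.
    by move=> y0 y00; congr pair; apply: val_inj; rewrite /= ym y00.
  have [|b Bb bE] := IHm (ord_pred y).
    rewrite /= ym addSn /= modnDr modn_small//.
    by apply: leq_trans (ltn_ord y); rewrite ym.
  by exists (fmul b c); [exact: B_mul | move=> y0 y00; rewrite /fmul cE (bE _ y00)].
have N0 : (0 < N n)%N by case: x => i [y]; exact: leq_trans.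
have to_o (z : X n) : exists2 b, B b & b n z = (ish 0, Ordinal N0).
  case: z => i y; have [b Bb bE] := to_sheet0 i y; have [d Bd dE] := to_base _ y erefl.
  by exists (fmul d b); [exact: B_mul | rewrite /fmul bE (dE (Ordinal N0))].
have [b Bb bE] := to_o x; have [d Bd dE] := to_o x'.
have [d' [Bd' d'd _]] := B_inv Bd.
exists (fmul d' b); first exact: B_mul.
by rewrite /fmul bE -dE; have /(congr1 (fun f : fam => f n x')) := d'd.
Qed.

(* Keeps simplification from enumerating the bit patterns. *)
Opaque patterns N spot letter.

(** * Rooted and spinal functions *)

Notation tagged_letter := {i : nat & X i}.

Definition spot0 n : 'I_(N n) := spot (fun=> false) n.
Definition relabel (b : fam) (a : tagged_letter) : tagged_letter :=
  Tagged X (b (tag a) (tagged a)).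
(** The letters of the ray; [isP] marks their neighbours, below which [dir] acts by rooted
    copies. *)
Definition isO (a : tagged_letter) := tagged a == (ish 0, spot0 (tag a)).
Definition isP (a : tagged_letter) := tagged a == (ish 1, spot0 (tag a)).

Definition rooted (b : fam) (s : seq tagged_letter) : seq tagged_letter :=
  if s is a :: w then relabel b a :: w else [::].

(* The spinal automorphism with label [b] along the ray of the letters [isO]. *)
Fixpoint dir (b : fam) (s : seq tagged_letter) : seq tagged_letter :=
  if s is a :: w then
    a :: (if isO a then dir b w else if isP a then rooted b w else w)
  else [::].

Lemma isOP a : isO a -> isP a = false.
Proof.
rewrite /isO /isP => /eqP ->; apply/negP => /eqP[/eqP].
by rewrite ish_eq.
Qed.

Lemma relabel1 a : relabel fone a = a. Proof. by case: a. Qed.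
Lemma relabelM b c a : relabel (fmul b c) a = relabel b (relabel c a). Proof. by []. Qed.
Lemma relabelK b b' : fmul b' b = fone -> cancel (relabel b) (relabel b').
Proof. by move=> b'b a; rewrite -relabelM b'b relabel1. Qed.

Lemma rooted1 : rooted fone = id.
Proof. by apply/funext => -[|a w] //=; rewrite relabel1. Qed.

Lemma rootedM b c : rooted (fmul b c) = rooted b \o rooted c.
Proof. by apply/funext => -[|a w]. Qed.

Lemma dir1 : dir fone = id.
Proof.
by apply/funext; elim=> // a w IHw /=; rewrite IHw rooted1; case: ifP => //; case: ifP.
Qed.

Lemma dirM b c : dir (fmul b c) = dir b \o dir c.
Proof.
apply/funext; elim=> // a w IHw /=; rewrite IHw rootedM.
by case: ifP => // aO; case: ifP.
Qed.

(* Functions on arbitrary strings of letters rather than automorphisms of X 0: each of them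
   acts on the trees of all the shifted sequences at once, so that sections stay in [spinal]. *)
Inductive spinal (C : fam -> Prop) : (seq tagged_letter -> seq tagged_letter) -> Prop :=
| spinal_one : spinal C id
| spinal_rooted b : B b -> spinal C (rooted b)
| spinal_dir c : C c -> spinal C (dir c)
| spinal_mul f g : spinal C f -> spinal C g -> spinal C (f \o g).

Lemma spinal_mono C D f : (forall b, C b -> D b) -> spinal C f -> spinal D f.
Proof.
move=> CD; elim=> *; [exact: spinal_one | exact: spinal_rooted | exact/spinal_dir/CD | exact: spinal_mul].
Qed.

Definition inv_closed (C : fam -> Prop) := forall b, C b ->
  exists b', [/\ C b', fmul b' b = fone & fmul b b' = fone].

Lemma spinal_inv C f : inv_closed C -> spinal C f -> exists f', [/\ spinal C f', cancel f f' & cancel f' f].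
Proof.
move=> CV; elim=> [|b Bb|c Cc|f1 f2 _ [g1 [G1 fg1 gf1]] _ [g2 [G2 fg2 gf2]]].
- by exists id; split=> //; exact: spinal_one.
- have [b' [Bb' b'b bb']] := B_inv Bb; exists (rooted b'); split; first exact: spinal_rooted.
  + by move=> s; rewrite -[LHS]/((rooted b' \o rooted b) s) -rootedM b'b rooted1.
  + by move=> s; rewrite -[LHS]/((rooted b \o rooted b') s) -rootedM bb' rooted1.
- have [c' [Cc' c'c cc']] := CV _ Cc; exists (dir c'); split; first exact: spinal_dir.
  + by move=> s; rewrite -[LHS]/((dir c' \o dir c) s) -dirM c'c dir1.
  + by move=> s; rewrite -[LHS]/((dir c \o dir c') s) -dirM cc' dir1.
- by exists (g2 \o g1); split; [exact: spinal_mul | exact: can_comp | exact: can_comp].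
Qed.

Lemma spinal_nil C f : spinal C f -> f [::] = [::].
Proof. by elim=> //= f1 f2 _ e1 _ e2; rewrite e2. Qed.

Lemma spinal_tag C f s : spinal C f -> map tag (f s) = map tag s.
Proof.
move=> Gf; elim: Gf s => [//|b _|c _|f1 f2 _ IH1 _ IH2] s; last by rewrite /= IH1.
  by case: s.
elim: s => //= a w IHw; case: ifP => aO; first by rewrite IHw.
by case: ifP => // aP; case: w {IHw}.
Qed.

Lemma spinal_size C f s : spinal C f -> size (f s) = size s.
Proof. by move=> Gf; rewrite -(size_map tag) (spinal_tag s Gf) size_map. Qed.

Lemma spinal_section1 C f a : (forall b, C b -> B b) -> spinal C f ->
  exists h a', spinal C h /\ forall w, f (a :: w) = a' :: h w.
Proof.
move=> CB Gf; elim: Gf a => [|b Bb|c Cc|f1 f2 _ IH1 _ IH2] a.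
- by exists id, a; split=> //; exact: spinal_one.
- by exists id, (relabel b a); split=> //; exact: spinal_one.
- case aO: (isO a); first by exists (dir c), a; split=> [|w /=]; [exact: spinal_dir | rewrite aO].
  case aP: (isP a).
    exists (rooted c), a; split=> [|w /=]; last by rewrite aO aP.
    exact/spinal_rooted/CB.
  by exists id, a; split=> [|w /=]; [exact: spinal_one | rewrite aO aP].
- have [h2 [a2 [H2 E2]]] := IH2 a; have [h1 [a1 [H1 E1]]] := IH1 a2.
  by exists (h1 \o h2), a1; split=> [|w /=]; [exact: spinal_mul | rewrite E2 E1].
Qed.

Lemma spinal_section C f u : (forall b, C b -> B b) -> spinal C f ->
  exists2 h, spinal C h & forall w, f (u ++ w) = f u ++ h w.
Proof.
move=> CB; elim: u f => [|a u IHu] f Gf; first by exists f => // w; rewrite (spinal_nil Gf).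
have [h [a' [Gh E]]] := spinal_section1 a CB Gf; have [h' Gh' E'] := IHu _ Gh.
by exists h' => // w; rewrite /= !E E'.
Qed.

Lemma spinal_prefix C f u w : (forall b, C b -> B b) -> spinal C f ->
  take (size u) (f (u ++ w)) = f u.
Proof.
move=> CB Gf; have [h _ ->] := spinal_section u CB Gf.
by rewrite take_size_cat// (spinal_size _ Gf).
Qed.

(** * Lifting to the subtree below one vertex *)

Definition star (xi : pred tagged_letter) h (s : seq tagged_letter) :=
  if s is a :: w then a :: (if xi a then h w else w) else [::].

Lemma star1 xi : star xi id = id.
Proof. by apply/funext => -[|a w] //=; rewrite if_same. Qed.

Lemma starM xi f g : star xi (f \o g) = star xi f \o star xi g.
Proof. by apply/funext => -[|a w] //=; case: ifP. Qed.

Lemma isO_twist (p : {perm sheet}) x : p (ish 0) = ish 0 -> isO (relabel (twist full p) x) = isO x.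
Proof.
by case: x => n [i y] p0; rewrite /isO /twist !xpair_eqE /= -{1}p0 (inj_eq perm_inj).
Qed.

Lemma isP_twist (p : {perm sheet}) x : p (ish 1) = ish 1 -> isP (relabel (twist full p) x) = isP x.
Proof.
by case: x => n [i y] p0; rewrite /isP /twist !xpair_eqE /= -{1}p0 (inj_eq perm_inj).
Qed.

Lemma isO_moved (p : {perm sheet}) x : p (ish 0) != ish 0 -> isO x -> isO (relabel (twist full p) x) = false.
Proof.
by case: x => n x p0 /eqP /= ->; rewrite /isO /twist xpair_eqE /= (negPf p0).
Qed.

Lemma isP_moved (p : {perm sheet}) x : p (ish 1) != ish 1 -> isP x -> isP (relabel (twist full p) x) = false.
Proof.
by case: x => n x p0 /eqP /= ->; rewrite /isP /twist xpair_eqE /= (negPf p0).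
Qed.

Definition fcomm (b c b' c' : fam) := fmul b (fmul c (fmul b' c')).

Lemma dir_conj a a' c x w : fmul a' a = fone ->
  (rooted a' \o dir c \o rooted a) (x :: w) =
  x :: (if isO (relabel a x) then dir c w else if isP (relabel a x) then rooted c w else w).
Proof. by move=> a'a /=; rewrite (relabelK a'a). Qed.

(** Conjugating by a rooted [a] that fixes the [isO] letters and moves the [isP] letters separates
    the rooted parts, which then cancel in the commutator; only the part on the ray remains. *)
Lemma spinal_star_dir b c b' c' : B b -> B c -> B b' -> B c' ->
  fmul b b' = fone -> fmul c c' = fone -> spinal B (star isO (dir (fcomm b c b' c'))).
Proof.
move=> Bb Bc Bb' Bc' bb' cc'.
pose p : {perm sheet} := cyc3 (ish 1) (ish 2) (ish 3).
have p0 : p (ish 0) = ish 0 by rewrite cyc3D ?ish_eq.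
have p1 : p (ish 1) != ish 1 by rewrite permM tpermL tpermD ?ish_eq.
pose a := twist full p.
have Ba : B a by apply/B_twist_full/cyc3_Alt; rewrite ish_eq.
have aO x : isO (relabel a x) = isO x by exact: isO_twist p0.
have aP x : isP x -> isP (relabel a x) = false by exact: isP_moved p1.
have [a' [Ba' a'a _]] := B_inv Ba.
move: (a) (a') aO aP Ba Ba' a'a => {p p0 p1 a}a {}a' aO aP Ba Ba' a'a.
pose rot d := rooted a' \o dir d \o rooted a.
have Grot d : B d -> spinal B (rot d).
  by move=> Bd; exact: spinal_mul (spinal_mul (spinal_rooted _ Ba') (spinal_dir Bd)) (spinal_rooted _ Ba).
suff -> : star isO (dir (fcomm b c b' c')) = dir b \o rot c \o (dir b' \o rot c').
  exact: spinal_mul (spinal_mul (spinal_dir Bb) (Grot _ Bc)) (spinal_mul (spinal_dir Bb') (Grot _ Bc')).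
have rotE d x w : rot d (x :: w) =
    x :: (if isO (relabel a x) then dir d w else if isP (relabel a x) then rooted d w else w).
  exact: dir_conj.
apply/funext => -[//|x w]; rewrite -[RHS]/(dir b (rot c (dir b' (rot c' (x :: w))))).
rewrite rotE [dir b' _]/= rotE [RHS]/= [LHS]/=; congr cons.
rewrite aO; case xO: (isO x); first by rewrite /fcomm 3!dirM.
case xP: (isP x).
  by rewrite aP// -[rooted b _]/((rooted b \o rooted b') w) -rootedM bb' rooted1.
by case: (isP _) => //; rewrite -[rooted c _]/((rooted c \o rooted c') w) -rootedM cc' rooted1.
Qed.

(** Here [a] fixes the [isP] letters and moves the ray, so the spinal parts cancel and the rooted
    parts give the commutator. *)
Lemma spinal_star_rooted b c b' c' : B b -> B c -> B b' -> B c' ->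
  fmul b b' = fone -> fmul c c' = fone -> spinal B (star isP (rooted (fcomm b c b' c'))).
Proof.
move=> Bb Bc Bb' Bc' bb' cc'.
pose p : {perm sheet} := cyc3 (ish 0) (ish 2) (ish 3).
have p1 : p (ish 1) = ish 1 by rewrite cyc3D ?ish_eq.
have p0 : p (ish 0) != ish 0 by rewrite permM tpermL tpermD ?ish_eq.
pose a := twist full p.
have Ba : B a by apply/B_twist_full/cyc3_Alt; rewrite ish_eq.
have aP x : isP (relabel a x) = isP x by exact: isP_twist p1.
have aO x : isO x -> isO (relabel a x) = false by exact: isO_moved p0.
have [a' [Ba' a'a _]] := B_inv Ba.
move: (a) (a') aO aP Ba Ba' a'a => {p p0 p1 a}a {}a' aO aP Ba Ba' a'a.
pose rot d := rooted a' \o dir d \o rooted a.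
have Grot d : B d -> spinal B (rot d).
  by move=> Bd; exact: spinal_mul (spinal_mul (spinal_rooted _ Ba') (spinal_dir Bd)) (spinal_rooted _ Ba).
suff -> : star isP (rooted (fcomm b c b' c')) = dir b \o rot c \o (dir b' \o rot c').
  exact: spinal_mul (spinal_mul (spinal_dir Bb) (Grot _ Bc)) (spinal_mul (spinal_dir Bb') (Grot _ Bc')).
have rotE d x w : rot d (x :: w) =
    x :: (if isO (relabel a x) then dir d w else if isP (relabel a x) then rooted d w else w).
  exact: dir_conj.
apply/funext => -[//|x w]; rewrite -[RHS]/(dir b (rot c (dir b' (rot c' (x :: w))))).
rewrite rotE [dir b' _]/= rotE [RHS]/= [LHS]/=; congr cons.
rewrite aP; case xO: (isO x).
  by rewrite isOP// aO// -[dir b _]/((dir b \o dir b') w) -dirM bb' dir1.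
case xP: (isP x).
  by case axO: (isO (relabel a x)); [have := isOP axO; rewrite aP xP | rewrite /fcomm 3!rootedM].
by case: (isO (relabel a x)) => //; rewrite -[dir c _]/((dir c \o dir c') w) -dirM cc' dir1.
Qed.

Lemma gen_commg k p q :
  gen k [~ p, q] = fcomm (gen k q) (gen k p) (gen k q^-1) (gen k p^-1).
Proof. by rewrite /commg /conjg !genM. Qed.

Lemma genK k p : fmul (gen k p) (gen k p^-1) = fone.
Proof. by rewrite -genM mulVg gen1. Qed.

(** By perfectness of [A6], every generator of [B] is a product of commutators of generators. *)
Lemma spinal_star_dirB b : B b -> spinal B (star isO (dir b)).
Proof.
elim=> [|k p pA|{}b c _ Gb _ Gc]; last by rewrite dirM starM; exact: spinal_mul.
  by rewrite dir1 star1; exact: spinal_one.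
apply: (@A6_commutator_ind (fun p => spinal B (star isO (dir (gen k p))))) pA.
- by rewrite gen1 dir1 star1; exact: spinal_one.
- by move=> q r Gq Gr; rewrite genM dirM starM; exact: spinal_mul.
- move=> q r qA rA; rewrite gen_commg.
  by apply: spinal_star_dir; rewrite ?genK//; apply: B_gen; rewrite ?groupV.
Qed.

Lemma spinal_star_rootedB b : B b -> spinal B (star isP (rooted b)).
Proof.
elim=> [|k p pA|{}b c _ Gb _ Gc]; last by rewrite rootedM starM; exact: spinal_mul.
  by rewrite rooted1 star1; exact: spinal_one.
apply: (@A6_commutator_ind (fun p => spinal B (star isP (rooted (gen k p))))) pA.
- by rewrite gen1 rooted1 star1; exact: spinal_one.
- by move=> q r Gq Gr; rewrite genM rootedM starM; exact: spinal_mul.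
- move=> q r qA rA; rewrite gen_commg.
  by apply: spinal_star_rooted; rewrite ?genK//; apply: B_gen; rewrite ?groupV.
Qed.

(** Conjugation by a rooted element taking [x] to [x0] moves the support to [x]. *)
Lemma spinal_move_star xi h n (x0 x : X n) :
  spinal B (star xi h) -> (forall y : X n, xi (Tagged X y) = (y == x0)) ->
  exists2 f, spinal B f & forall (y : X n) w,
    f (Tagged X y :: w) = Tagged X y :: (if y == x then h w else w).
Proof.
move=> Gh xiE; have [b Bb bx] := B_transitive x x0; have [b' [Bb' b'b _]] := B_inv Bb.
exists (rooted b' \o star xi h \o rooted b).
  exact: spinal_mul (spinal_mul (spinal_rooted _ Bb') Gh) (spinal_rooted _ Bb).
move=> y w /=; rewrite (relabelK b'b); congr cons; rewrite xiE -bx (inj_eq _)//.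
by apply: (can_inj (g := b' n)) => z; have /(congr1 (fun f : fam => f n z)) := b'b.
Qed.

Lemma spinal_lift1 f n (x : X n) : spinal B f -> exists2 f', spinal B f' & forall (y : X n) w,
  f' (Tagged X y :: w) = Tagged X y :: (if y == x then f w else w).
Proof.
elim=> [|b Bb|b Bb|f1 f2 _ [g1 G1 E1] _ [g2 G2 E2]].
- by exists id => [|y w]; [exact: spinal_one | case: ifP].
- by apply: (@spinal_move_star isP _ _ (ish 1, spot0 n)) => //; exact: spinal_star_rootedB.
- by apply: (@spinal_move_star isO _ _ (ish 0, spot0 n)) => //; exact: spinal_star_dirB.
- by exists (g1 \o g2) => [|y w]; [exact: spinal_mul | rewrite /= E2 E1; case: (y == x)].
Qed.

Lemma is_string_cons k (a : tagged_letter) w :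
  is_string k (a :: w) = (tag a == k) && is_string k.+1 w.
Proof. by rewrite /is_string /= eqseq_cons. Qed.

(** This puts a copy of every spinal function into the rigid stabiliser of [u], one letter at a
    time. *)
Lemma spinal_lift f k u : spinal B f -> is_string k u -> exists2 f', spinal B f' &
  forall u' w, is_string k u' -> size u' = size u ->
    f' (u' ++ w) = u' ++ (if u' == u then f w else w).
Proof.
move=> Gf; elim: u k => [|a u IHu] k; first by exists f => // -[].
rewrite is_string_cons => /andP[/eqP ak /IHu[g Gg gE]].
case: a ak => n x /= nk; rewrite {}nk in x *.
have [f' Gf' fE] := spinal_lift1 x Gg; exists f' => // -[//|[m y] u'] w.
rewrite is_string_cons => /andP[/= /eqP mk su' [szu]]; rewrite {}mk in y *.
rewrite fE eqseq_cons; congr cons.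
rewrite [X in X && _](_ : _ = (y == x)) -?[RHS]tag_eqE ?eq_Tagged //.
by case: eqP => //= _; rewrite gE.
Qed.

Lemma spinal_transitive k u v : is_string k u -> is_string k v -> size u = size v ->
  exists2 f, spinal B f & f u = v.
Proof.
elim: u k v => [|a u IHu] k [|a' v]//; first by exists id => //; exact: spinal_one.
rewrite !is_string_cons => /andP[/eqP ak su] /andP[/eqP ak' sv] [/(IHu _ _ su sv)[f Gf fE]].
case: a ak => n x /= nk; rewrite {}nk in x *.
case: a' ak' => m y /= mk; rewrite {}mk in y *.
have [b Bb bE] := B_transitive x y; have [f' Gf' f'E] := spinal_lift1 y Gf.
exists (f' \o rooted b); first exact: spinal_mul (spinal_rooted _ Bb).
by rewrite /= /relabel /= bE f'E eqxx fE.
Qed.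

(** * Contraction *)

Definition nucleus (C : fam -> Prop) f :=
  (exists2 b, B b & f = rooted b) \/ (exists2 c, C c & f = dir c).

Definition contracts C n (f : seq tagged_letter -> seq tagged_letter) :=
  forall u, size u = n -> exists h u',
    [/\ nucleus C h, size u' = n & forall w, f (u ++ w) = u' ++ h w].

Section Contraction.
Variable C : fam -> Prop.
Hypotheses (C1 : C fone) (CM : forall b c, C b -> C c -> C (fmul b c)).
Hypothesis CB : forall b, C b -> B b.

Lemma nucleus1 : nucleus C id.
Proof. by right; exists fone; rewrite ?dir1. Qed.

Lemma nucleus_section f a : nucleus C f ->
  exists h a', nucleus C h /\ forall w, f (a :: w) = a' :: h w.
Proof.
case=> -[b Cb ->]; first by exists id, (relabel b a); split=> //; exact: nucleus1.
case aO: (isO a).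
  by exists (dir b), a; split=> [|w /=]; [right; exists b | rewrite aO].
case aP: (isP a).
  by exists (rooted b), a; split=> [|w /=]; [left; exists b; [exact: CB|] | rewrite aO aP].
by exists id, a; split=> [|w /=]; [exact: nucleus1 | rewrite aO aP].
Qed.

(* Two elements of the nucleus multiply to a generator unless exactly one of them is
   rooted, and rooted elements have trivial sections. *)
Lemma nucleus_mul_section f g a : nucleus C f -> nucleus C g ->
  exists h a', nucleus C h /\ forall w, f (g (a :: w)) = a' :: h w.
Proof.
move=> nf ng; case: (ng) => -[b Cb gE].
  have [h [a' [nh hE]]] := nucleus_section (relabel b a) nf.
  by exists h, a'; split=> // w; rewrite gE /= hE.
case: (nf) => -[c Cc fE].
  have [h [a' [nh hE]]] := nucleus_section a ng.
  by exists h, (relabel c a'); split=> // w; rewrite hE fE.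
have [|h [a' [nh hE]]] := @nucleus_section (dir (fmul c b)) a.
  by right; exists (fmul c b) => //; exact: CM.
by exists h, a'; split=> // w; rewrite -hE dirM fE gE.
Qed.

Lemma contractsS n f : contracts C n f -> contracts C n.+1 f.
Proof.
move=> cf u; case/lastP: u => // u a; rewrite size_rcons => -[/cf[h [u' [nh szu' hE]]]].
have [h' [a' [nh' h'E]]] := nucleus_section a nh.
exists h', (rcons u' a'); split=> //; first by rewrite size_rcons szu'.
by move=> w; rewrite !cat_rcons hE h'E.
Qed.

Lemma contracts_leq m n f : (m <= n)%N -> contracts C m f -> contracts C n f.
Proof. by move=> /subnK <-; elim: (n - m)%N => // k IHk /IHk; exact: contractsS. Qed.

(** At level [n] the section is a product of two elements of the nucleus; one more letter brings it
    back into the nucleus. *)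
Lemma contracts_mul n f g : contracts C n f -> contracts C n g -> contracts C n.+1 (f \o g).
Proof.
move=> cf cg u; case/lastP: u => // u a; rewrite size_rcons => -[/cg[h [u' [nh szu' hE]]]].
have [h' [u'' [nh' szu'' h'E]]] := cf _ szu'.
have [l [a' [nl lE]]] := nucleus_mul_section a nh' nh.
exists l, (rcons u'' a'); split=> //; first by rewrite size_rcons szu''.
by move=> w; rewrite !cat_rcons /= hE h'E lE.
Qed.

Lemma spinal_contracts f : spinal C f -> exists n, contracts C n f.
Proof.
have contracts0 h : nucleus C h -> contracts C 0 h.
  by move=> nh u /size0nil ->; exists h, [::].
elim=> [|b Bb|c Cc|f1 f2 _ [n cn] _ [m cm]].
- by exists 0; apply: contracts0; exact: nucleus1.
- by exists 0; apply: contracts0; left; exists b.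
- by exists 0; apply: contracts0; right; exists c.
- exists (maxn n m).+1; apply: contracts_mul.
    by apply: contracts_leq cn; rewrite leq_maxl.
  by apply: contracts_leq cm; rewrite leq_maxr.
Qed.

Definition ray k m : seq tagged_letter :=
  [seq Tagged X ((ish 0, spot0 i) : X i) | i <- iota k m].

Lemma ray_string k m : is_string k (ray k m).
Proof. by rewrite /is_string size_map size_iota -map_comp /comp /= map_id. Qed.

Lemma size_ray k m : size (ray k m) = m.
Proof. by rewrite size_map size_iota. Qed.

Lemma dir_ray b k m w : dir b (ray k m ++ w) = ray k m ++ dir b w.
Proof. by elim: m k => //= m IHm k; rewrite /isO /= eqxx IHm. Qed.

(** On the ray [dir b] is its own section, while deep sections of [f] are in the nucleus; comparing
    them recovers [b] at almost all levels. *)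
Lemma spinal_dir_germ f b : spinal C f -> (forall s, is_string 0 s -> f s = dir b s) ->
  exists c m, C c /\ forall n, (m <= n)%N -> forall x, b n x = c n x.
Proof.
move=> /spinal_contracts[n cf] fE; have [h [u' [nh szu' hE]]] := cf _ (size_ray 0 n).
have {hE}hE w : is_string n w -> h w = dir b w.
  move=> nw; have := fE (ray 0 n ++ w).
  rewrite is_string_cat ray_string size_ray add0n => /(_ nw).
  rewrite hE dir_ray => /eqP; rewrite eqseq_cat ?szu' ?size_ray//.
  by case/andP=> _ /eqP.
(* These words follow the ray to level [l], leave it through an [isP] letter and end in [x]; [dir d]
   changes only the last letter, by [d] at level [l.+1]. *)
pose w l (x : X l.+1) : seq tagged_letter :=
  ray n (l - n) ++ [:: Tagged X ((ish 1, spot0 l) : X l); Tagged X x].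
have wn l x : (n <= l)%N -> is_string n (@w l x).
  move=> nl; rewrite is_string_cat ray_string size_ray subnKC//.
  by rewrite !is_string_cons /= !eqxx.
have dirw d l x : dir d (@w l x) = @w l (d _ x).
  by rewrite dir_ray /= /isO /isP /= !xpair_eqE /= !eqxx ish_eq.
have w_inj l : injective (@w l).
  move=> x y /(congr1 (last (Tagged X x))); rewrite !last_cat /= => /eqP.
  by rewrite eq_Tagged => /eqP.
case: nh => -[c Cc hc]; last first.
  by exists c, n.+1; split=> // -[//|l] nl x; apply: w_inj; rewrite -!dirw -hE ?wn// hc.
(* A rooted map changes only the first letter of these words of length at least 2, so [b] is trivial
   at these levels. *)
exists fone, n.+1; split=> // -[//|l] nl x.
have : rooted c (@w l x) = @w l (b _ x) by rewrite -dirw -hE ?wn// hc.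
move=> /(congr1 (last (Tagged X x))); rewrite last_cat /=.
rewrite (_ : last _ (rooted _ _) = Tagged X x).
  by move=> /esym/eqP; rewrite eq_Tagged => /eqP.
by rewrite /w; case: (ray _ _) => //= a s; rewrite last_cat.
Qed.
End Contraction.

(** * Maximal subgroups of finitely generated groups *)

Lemma subgroupP (G : groupType) (H : set G) :
  subgroup H <-> H 1 /\ (forall x y, H x -> H y -> H (x * y^-1)).
Proof.
split=> [[H1 HB]|[H1 HB]]; split.
- by move: H1; rewrite inE.
- by move=> x y Hx Hy; have := HB x y; rewrite !inE; exact.
- by rewrite inE.
- by move=> x y; rewrite !inE; exact: HB.
Qed.

Lemma subgroupV (G : groupType) (H : set G) x : subgroup H -> H x -> H x^-1.
Proof. by move=> /subgroupP[H1 HB] Hx; rewrite -[x^-1]mul1g; exact: HB. Qed.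

Lemma subgroupM (G : groupType) (H : set G) x y : subgroup H -> H x -> H y -> H (x * y).
Proof.
by move=> sH Hx Hy; rewrite -[y]invgK; have /subgroupP[_] := sH; apply=> //; exact: subgroupV.
Qed.

Lemma generated_subgroup (G : groupType) (S : set G) : subgroup (generated S).
Proof.
apply/subgroupP; split=> [A [/subgroupP[]]//|x y Sx Sy A [sA SA]].
have /subgroupP[_] := sA; apply; [exact: Sx | exact: Sy].
Qed.

Lemma coset_eq (G : groupType) (H : set G) x y : subgroup H -> H (x * y^-1) ->
  [set h * x | h in H] = [set h * y | h in H].
Proof.
move=> sH Hxy; apply/seteqP; split=> _ [h Hh <-].
  by exists (h * (x * y^-1)); [exact: subgroupM | rewrite -!mulgA mulVg mulg1].
exists (h * (x * y^-1)^-1); first by apply: subgroupM => //; exact: subgroupV.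
by rewrite invgM invgK -!mulgA mulVg mulg1.
Qed.

Lemma maximal_subgroup_above (G : groupType) (Gamma H : set G) :
  subgroup Gamma -> finitely_generated Gamma -> subgroup H -> H `<` Gamma ->
  exists2 M, maximal_subgroup M Gamma & H `<=` M.
Proof.
move=> sGamma [S Sfin GammaE] sH [HG nGH].
pose proper A := [/\ subgroup A, H `<=` A, A `<=` Gamma & ~ Gamma `<=` A].
have H1 : H 1 by case/subgroupP: sH.
have [] := @Zorn_bigcup _ (fun A => A = set0 \/ proper A).
  move=> F FP totF.
  have [[K0 FK0 pK0]|noK] := pselect (exists2 K, F K & proper K); last first.
    left; rewrite -subset0 => x [K FK Kx]; case: (FP _ FK) => [K0|pK].
      by rewrite K0 in Kx.
    by case: noK; exists K.
  have FPx K x : F K -> K x -> proper K.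
    by move=> FK Kx; case: (FP _ FK) => // K_0; rewrite K_0 in Kx.
  have join K L : F K -> F L -> exists J, [/\ F J, K `<=` J & L `<=` J].
    by move=> FK FL; case: (totF K L FK FL) => KL; [exists L; split=> // | exists K; split=> //].
  right; split.
  - apply/subgroupP; split.
      by exists K0 => //; case: pK0 => _ HK0 _ _; exact: HK0.
    move=> x y [K FK Kx] [L FL Ly]; have [J [FJ KJ LJ]] := join _ _ FK FL.
    exists J => //; have [/subgroupP[_ JB] _ _ _] := FPx _ _ FJ (KJ _ Kx).
    by apply: JB; [exact: KJ | exact: LJ].
  - by move=> x Hx; exists K0 => //; case: pK0 => _ HK0 _ _; exact: HK0.
  - by move=> x [K FK Kx]; have [_ _ KG _] := FPx _ _ FK Kx; exact: KG.
  (* Otherwise the finite set [S] would lie in a single member of the chain, which would then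
     contain [Gamma]. *)
  - move=> GF; have SF : S `<=` \bigcup_(K in F) K.
      move=> x Sx; apply: GF; rewrite GammaE => A [_ SA]; exact: SA.
    (* Starting from [K0] ensures that the member found is not the empty set. *)
    have [K FK SK] : exists2 K, F K /\ K0 `<=` K & S `<=` K.
      have [s SE] := (finite_seqP _).1 Sfin; rewrite {}SE in SF *.
      elim: s SF => [|x s IHs] SF; first by exists K0; [split=> // | move=> x].
      have [|K [FK K0K] sK] := IHs; first by move=> y ys; apply: SF; rewrite /= in_cons ys orbT.
      have [|L FL Lx] := SF x; first by rewrite /= mem_head.
      have [J [FJ KJ LJ]] := join _ _ FK FL.
      exists J; first by split=> // y /K0K/KJ.
      by move=> y /=; rewrite in_cons => /orP[/eqP ->|/sK/KJ //]; exact: LJ.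
    case: FK => FK K0K; have [sK _ _ nGK] := FPx K 1 FK (K0K 1 (let: And4 _ a _ _ := pK0 in a 1 H1)).
    by apply: nGK; rewrite GammaE => x; apply.
move=> M [[M0|[sM HM MG nGM]] maxM].
  case: (maxM H); last by right; split.
  by rewrite M0; split=> // /(_ _ H1).
exists M => //; split=> // K sK MK KG.
have [GK|nGK] := pselect (Gamma `<=` K); first by right; exact/seteqP.
left; apply/seteqP; split=> //; apply: contrapT => nKM.
by apply: (maxM K); [split | right; split=> // x /HM/MK].
Qed.

(** * From functions on strings to tree automorphisms *)

Definition realizes f (g : tree_aut X 0) := forall v, letters (g v) = f (letters v).

(* Gamma_C in the notation of the header; Gamma itself is [spinal_group B]. *)
Definition spinal_group C : set (tree_aut X 0) := [set g | exists2 f, spinal C f & realizes f g].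

(** Spinal functions preserve lengths and prefixes, and so do their inverses. *)
Lemma spinal_realizable f : spinal B f -> exists g, realizes f g.
Proof.
move=> Gf; have BV := B_inv.
have stringP f' (v : vertex X 0) : spinal B f' -> is_string 0 (f' (letters v)).
  by move=> Gf'; rewrite /is_string (spinal_tag _ Gf') (spinal_size _ Gf') -/(is_string 0 v) lettersP.
have [f' [Gf' fK f'K]] := spinal_inv BV Gf.
pose F v := Vertex (stringP f v Gf); pose F' v := Vertex (stringP f' v Gf').
have childF f1 (Gf1 : spinal B f1) u v : child u v ->
    child (Vertex (stringP f1 u Gf1)) (Vertex (stringP f1 v Gf1)).
  case=> x /= vE; have [h Gh hE] := spinal_section u (fun b Bb => Bb) Gf1.
  have := spinal_size [:: x] Gh; rewrite /child /= vE -cats1 hE.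
  by case: (h _) => [|y [|]]// _; exists y; rewrite cats1.
have FK : cancel F F' by move=> v; apply: val_inj; rewrite /= fK.
have F'K : cancel F' F by move=> v; apply: val_inj; rewrite /= f'K.
have autF : is_tree_aut F.
  split; first by exists F'.
    by apply: val_inj; rewrite /= (spinal_nil Gf).
  move=> u v; split=> -[] uv.
  - by left; exact: childF.
  - by right; exact: childF.
  - by left; rewrite -(FK u) -(FK v); exact: childF.
  - by right; rewrite -(FK u) -(FK v); exact: childF.
by exists (TreeAut autF).
Qed.

Lemma realizes_inj f g g' : realizes f g -> realizes f g' -> g = g'.
Proof. by move=> fg fg'; apply: tree_aut_ext => v; apply: val_inj; rewrite /= fg fg'. Qed.

Lemma realizes1 : realizes id 1. Proof. by []. Qed.

Lemma realizesM f f' g g' : realizes f g -> realizes f' g' -> realizes (f' \o f) (g * g').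
Proof. by move=> fg fg' v; rewrite /= fg' fg. Qed.

Lemma realizesV f f' g : cancel f f' -> realizes f g -> realizes f' g^-1.
Proof.
by move=> fK fg v; rewrite -[in RHS](aut_inv_funK g v) fg fK.
Qed.

Lemma spinal_group_subgroup C : inv_closed C -> subgroup (spinal_group C).
Proof.
move=> CV; apply/subgroupP; split; first by exists id; [exact: spinal_one | exact: realizes1].
move=> x y [f Gf fx] [f1 Gf1 f1y]; have [f1' [Gf1' f1K _]] := spinal_inv CV Gf1.
by exists (f1' \o f); [exact: spinal_mul | apply: realizesM => //; exact: realizesV f1y].
Qed.

Section GeneratedBy.
Variable M : set (tree_aut X 0).
Hypothesis sM : subgroup M.

Let realized_in f := forall g, realizes f g -> M g.

Lemma realized_one : realized_in id.
Proof. by move=> g g1; rewrite (realizes_inj g1 realizes1); case/subgroupP: sM. Qed.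

Lemma realized_mul f1 f2 : spinal B f1 -> spinal B f2 ->
  realized_in f1 -> realized_in f2 -> realized_in (f1 \o f2).
Proof.
move=> Gf1 Gf2 M1 M2 g fg; have [g1 fg1] := spinal_realizable Gf1.
have [g2 fg2] := spinal_realizable Gf2.
rewrite (realizes_inj fg (realizesM fg2 fg1)).
by apply: subgroupM => //; [exact: M2 | exact: M1].
Qed.

Lemma spinal_group_sub : (forall b, B b -> realized_in (rooted b)) ->
  (forall b, B b -> realized_in (dir b)) -> spinal_group B `<=` M.
Proof.
move=> Mr Md g [f Gf]; elim: Gf g => [|b Bb|b Bb|f1 f2 Gf1 M1 Gf2 M2].
- exact: realized_one.
- exact: Mr.
- exact: Md.
- exact: realized_mul.
Qed.

Lemma spinal_group_sub_gen : (forall k p, p \in A6 -> realized_in (rooted (gen k p))) ->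
  (forall k p, p \in A6 -> realized_in (dir (gen k p))) -> spinal_group B `<=` M.
Proof.
move=> Mr Md; apply: spinal_group_sub => b.
  elim=> [|k p pA|{}b c Bb Mb Bc Mc]; [|exact: Mr|].
    by rewrite rooted1; exact: realized_one.
  by rewrite rootedM; apply: realized_mul => //; exact: spinal_rooted.
elim=> [|k p pA|{}b c Bb Mb Bc Mc]; [|exact: Md|].
  by rewrite dir1; exact: realized_one.
by rewrite dirM; apply: realized_mul => //; exact: spinal_dir.
Qed.
End GeneratedBy.

Lemma spinal_group_finitely_generated : finitely_generated (spinal_group B).
Proof.
pose h (x : bool * (option bool * {perm sheet})) :=
  let b := gen x.2.1 x.2.2 in if x.1 then rooted b else dir b.
(* For permutations in [A6] a realization exists, so the default 1 is not taken. *)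
pose r x := xget 1 (realizes (h x)).
have Gh x : x.2.2 \in A6 -> spinal B (h x).
  move=> /(B_gen x.2.1) Bx; rewrite /h; case: x.1; [exact: spinal_rooted | exact: spinal_dir].
have rP x : x.2.2 \in A6 -> realizes (h x) (r x).
  by move=> /Gh/spinal_realizable[g hg]; rewrite /r; case: xgetP => [y _ //|/(_ g)].
pose S := [set r x | x in [set x | x.2.2 \in A6]].
exists S; first exact: finite_image finite_finset.
apply/seteqP; split=> [|]; last first.
  apply: smallest_sub; first exact/spinal_group_subgroup/B_inv.
  by move=> _ [x xA <-]; exists (h x); [exact: Gh | exact: rP].
move=> g gG A [sA SA]; apply: (spinal_group_sub_gen sA) gG => k p pA {}g hg; apply: SA.
  by exists (true, (k, p)) => //; exact: realizes_inj (rP (true, (k, p)) pA) hg.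
by exists (false, (k, p)) => //; exact: realizes_inj (rP (false, (k, p)) pA) hg.
Qed.

Lemma stabB s b : stab s b -> B b. Proof. by case. Qed.

Lemma spinal_group_mono s : spinal_group (stab s) `<=` spinal_group B.
Proof. by move=> g [f Gf fg]; exists f => //; exact: (spinal_mono (@stabB s)). Qed.

(** If [dir b] were realized in the smaller group, its germ along the ray would give an element of
    [stab s] agreeing with [b] at almost all levels. *)
Lemma spinal_group_stab_proper s : spinal_group (stab s) `<` spinal_group B.
Proof.
split; first exact: spinal_group_mono.
have [b Bb bs] := stab_proper s; have [g bg] := spinal_realizable (spinal_dir Bb).
move=> /(_ g) []; first by exists (dir b) => //; exact: spinal_dir.
move=> f Gf fg.
have [] := @spinal_dir_germ (stab s) (stab_one s) (@stab_mul s) (@stabB s) f b Gf.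
  by move=> w wP; rewrite -[w]/(letters (Vertex wP)) -fg bg.
by move=> c [m [Cc bc]]; exact: bs bc.
Qed.

Lemma spinal_group_stab_join s t M : s <> t -> subgroup M ->
  spinal_group (stab s) `<=` M -> spinal_group (stab t) `<=` M -> spinal_group B `<=` M.
Proof.
move=> st sM Ms Mt; apply: (spinal_group_sub sM) => [b Bb g bg|].
  by apply: Ms; exists (rooted b) => //; exact: spinal_rooted.
(* Membership in [B] is carried along because closure under products needs realizations of both
   factors. *)
move=> b Bb; suff : B b /\ forall g, realizes (dir b) g -> M g by case.
apply: (@stab_generate s t (fun b => B b /\ forall g, realizes (dir b) g -> M g)) Bb => //.
- by split; [exact: B_one | rewrite dir1; exact: realized_one].
- move=> c d [Bc Mc] [Bd Md]; split; first exact: B_mul.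
  by rewrite dirM; apply: realized_mul => //; exact: spinal_dir.
- move=> c Cc; split=> [|g cg]; first exact: stabB Cc.
  by apply: Ms; exists (dir c) => //; exact: spinal_dir.
- move=> c Cc; split=> [|g cg]; first exact: stabB Cc.
  by apply: Mt; exists (dir c) => //; exact: spinal_dir.
Qed.

(** * Rigid stabilisers *)

Fixpoint level k n : seq (seq tagged_letter) :=
  if n is m.+1 then [seq Tagged X x :: w | x <- enum (X k), w <- level k.+1 m] else [:: [::]].

Lemma mem_level k u : is_string k u -> u \in level k (size u).
Proof.
elim: u k => [|[n x] u IHu] k; first by rewrite mem_seq1.
rewrite is_string_cons => /andP[/= /eqP nk /IHu uL]; rewrite {}nk in x *.
by apply/allpairsPdep; exists x, u; rewrite mem_enum.
Qed.

Lemma realizes_fix_eq1 n f g : spinal B f -> realizes f g ->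
  (forall u w, is_string 0 u -> size u = n -> f (u ++ w) = u ++ w) -> g = 1.
Proof.
move=> Gf fg fix_f; apply: tree_aut_ext => v; apply: val_inj; rewrite /= fg.
have fix_long s : is_string 0 s -> (n <= size s)%N -> f s = s.
  move=> s0 ns; rewrite -{1}(cat_take_drop n s) fix_f ?cat_take_drop ?size_takel//.
  by move: s0; rewrite -{1}(cat_take_drop n s) is_string_cat => /andP[].
(* A vertex, possibly shorter than [n], is lengthened along the ray and then recovered as a
   prefix. *)
have ext_v : f (letters v ++ ray (size v) n) = letters v ++ ray (size v) n.
  apply: fix_long; first by rewrite is_string_cat lettersP ray_string.
  by rewrite size_cat size_ray leq_addl.
by rewrite -(spinal_prefix (letters v) (ray (size v) n) (fun b Bb => Bb) Gf) ext_v take_size_cat.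
Qed.

Lemma Rist_subgroup n : subgroup (Rist (spinal_group B) n).
Proof. exact: generated_subgroup. Qed.

(** [L] lists the vertices where the section of [f] may be nontrivial. Lifting the section at the
    head of [L] gives an element of its rigid stabiliser, and dividing by it removes that vertex. *)
Lemma fixed_level_Rist (L : seq (seq tagged_letter)) n f g : spinal B f -> realizes f g ->
  (forall u, is_string 0 u -> size u = n -> f u = u) ->
  (forall u w, is_string 0 u -> size u = n -> u \notin L -> f (u ++ w) = u ++ w) ->
  Rist (spinal_group B) n g.
Proof.
elim: L f g => [|v L IHL] f g Gf fg fix_u fix_f.
  rewrite (realizes_fix_eq1 (n := n) Gf fg); last by move=> u w su szu; exact: fix_f.
  by have /subgroupP[] := Rist_subgroup n.
(* Entries of [L] that are not vertices of level [n] are discarded. *)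
have [/andP[sv /eqP szv]|nv] := boolP (is_string 0 v && (size v == n)); last first.
  apply: (IHL f) => // u w su szu uL; apply: fix_f => //.
  by rewrite in_cons negb_or uL andbT; apply: contra nv => /eqP <-; rewrite su szu eqxx.
have [h Gh hE] := spinal_section v (fun b Bb => Bb) Gf; rewrite fix_u// in hE.
have [r Gr rE] := spinal_lift Gh sv; rewrite szv in rE.
have [r' [Gr' rK r'K]] := spinal_inv B_inv Gr.
have [gr rgr] := spinal_realizable Gr.
have r_level u : is_string 0 u -> size u = n -> r u = u.
  by move=> su szu; have := rE u [::] su szu; rewrite (spinal_nil Gh) if_same cats0.
have -> : g = g * gr^-1 * gr by rewrite -mulgA mulVg mulg1.
apply: (subgroupM (Rist_subgroup n)).
  apply: (IHL (r' \o f)); first exact: spinal_mul.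
  - by apply: realizesM => //; exact: realizesV rgr.
  - by move=> u su szu; rewrite /= fix_u// -{1}(r_level u)// rK.
  - move=> u w su szu uL /=; have [uv|uv] := eqVneq u v.
      have := rE u w su szu; rewrite uv eqxx hE => <-; exact: rK.
    rewrite fix_f// ?in_cons ?negb_or ?uv//.
    by have := rE u w su szu; rewrite (negPf uv) => {1}<-; exact: rK.
move=> A [_ SA]; apply: SA; exists (Vertex sv) => //; split.
- by exists r.
- by move=> u; rewrite /= szv => szu; apply: val_inj; rewrite /= rgr r_level// lettersP.
- move=> u; rewrite /= szv => szu uv; apply: tree_aut_ext => w; apply: val_inj.
  rewrite /= rgr /= rE ?lettersP//.
  have /negPf-> : letters u != v by apply/eqP => uv'; apply: uv; exact: val_inj.
  by rewrite drop_size_cat.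
Qed.

Lemma spinal_group_transitive : spherically_transitive (spinal_group B).
Proof.
move=> u v uv; have [f Gf fuv] := spinal_transitive (lettersP u) (lettersP v) uv.
have [g fg] := spinal_realizable Gf; exists g; first by exists f.
by apply: val_inj; rewrite /= fg.
Qed.

(** Elements with the same action on level [n] differ by an element fixing that level, which lies in
    [Rist]; and there are finitely many actions. *)
Lemma Rist_finite_index n : finite_index (Rist (spinal_group B) n) (spinal_group B).
Proof.
split; first exact: Rist_subgroup.
  by apply: smallest_sub; [exact/spinal_group_subgroup/B_inv | move=> g [v _ []]].
pose L := level 0 n.
pose code (x : tree_aut X 0) : {ffun 'I_(size L) -> 'I_(size L).+1} :=
  [ffun i : 'I_(size L) => inord (index (letters (x (insubd (root X 0) (nth [::] L i)))) L)].
have codeE x y (v : vertex X 0) : code x = code y -> size v = n -> x v = y v.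
  move=> xy szv; have memL (w : vertex X 0) : size w = n -> letters w \in L.
    by move=> szw; rewrite /L -szw mem_level// lettersP.
  have iL : (index (letters v) L < size L)%N by rewrite index_mem memL.
  have /(congr1 val) := congr1 (fun c : {ffun _ -> _} => c (Ordinal iL)) xy.
  rewrite !ffunE /= nth_index ?memL// valKd.
  rewrite !inordK ?ltnS ?index_size// => /(congr1 (nth [::] L)).
  by rewrite !nth_index ?memL ?aut_size// => /val_inj.
(* A coset is represented by a chosen element with code [c]; the default 1 fills in for codes not
   attained. *)
pose F c := [set h * xget 1 [set y | spinal_group B y /\ code y = c] | h in Rist (spinal_group B) n].
apply: (@sub_finite_set _ _ (F @` setT)); last exact: finite_image finite_finset.
move=> _ [x Gx <-]; exists (code x) => //; rewrite /F.
case: xgetP => [y _ [Gy yx]|/(_ x) []//]; apply/coset_eq; first exact: Rist_subgroup.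
have /subgroupP[_ GB] := spinal_group_subgroup B_inv; have [f Gf fyx] := GB _ _ Gy Gx.
apply: (@fixed_level_Rist (level 0 n) n f) => // [u su szu|u w su szu].
  rewrite -[u]/(letters (Vertex su)) -fyx -[LHS]/(letters (aut_inv_fun x (y _))).
  by rewrite (codeE _ _ _ yx)// aut_funK.
by rewrite -szu mem_level.
Qed.

(** * Uncountably many maximal subgroups *)

Lemma not_countable_injection T (A : set T) (F : (nat -> bool) -> T) :
  injective F -> (forall s, A (F s)) -> ~ countable A.
Proof.
move=> Finj AF /countable_injP[f finj].
have fF_inj s t : f (F s) = f (F t) -> s = t.
  by move=> /finj; rewrite !inE => /(_ (AF s) (AF t))/Finj.
(* Cantor's diagonal: [D] is false at [f (F s)] whenever [s] is true there. *)
pose D n := ~~ `[< exists2 s, f (F s) = n & s n >].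
case DD: (D (f (F D))); move: (DD); rewrite {1}/D.
  by move=> /asboolPn; apply; exists D.
by move=> /negbFE/asboolP[s /fF_inj ->]; rewrite DD.
Qed.

Theorem corollary9 :
  exists (X : nat -> finType) (Gamma : set (tree_aut X 0)),
    [/\ forall n : nat, (1 < #|X n|)%N,
        subgroup Gamma,
        finitely_generated Gamma,
        branch Gamma &
        ~ countable [set M : set (tree_aut X 0) | maximal_subgroup M Gamma]].
Proof.
have sGam := spinal_group_subgroup B_inv.
exists X, (spinal_group B); split => //.
- move=> n; rewrite card_prod !card_ord (@leq_trans 6)// leq_pmulr//.
  exact: leq_ltn_trans (ltn_ord (spot0 n)).
- exact: spinal_group_finitely_generated.
- by split; [exact: spinal_group_transitive | exact: Rist_finite_index].
have stab_max s : exists2 M, maximal_subgroup M (spinal_group B) & spinal_group (stab s) `<=` M.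
  apply: maximal_subgroup_above => //; first exact: spinal_group_finitely_generated.
    by apply: spinal_group_subgroup => b; exact: stab_inv.
  exact: spinal_group_stab_proper.
pose M s := s2val (cid2 (stab_max s)).
have maxM s : maximal_subgroup (M s) (spinal_group B) by exact: (s2valP (cid2 (stab_max s))).
have subM s : spinal_group (stab s) `<=` M s by exact: (s2valP' (cid2 (stab_max s))).
(* If [M s = M t] with [s <> t], then [M s] contains the groups of both and hence the whole group,
   against properness. *)
apply: (@not_countable_injection _ _ M) => // s t Mst; apply: contrapT => st.
have [sM [_ nGM] _] := maxM s; apply: nGM; apply: (spinal_group_stab_join st) => //.
by rewrite Mst.
Qed.
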